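(* Let $\langle\mathfrak K^{\heartsuit},\mathfrak K\rangle$ be a normed category with the almost amalgamation property. Then it has at most one Fraïssé sequence, up to an approximate 0-isomorphism: if $\vec u$ and $\vec v$ are Fraïssé sequences in $\langle\mathfrak K^{\heartsuit},\mathfrak K\rangle$, then there exists an approximate isomorphism $H\colon\vec u\to\vec v$ with $\mu(H)=0$.
   Context: A category $\mathfrak K$ is metric-enriched if each hom-set $\mathfrak K(a,b)$ carries a metric $\rho$ (the value $+\infty$ is allowed) such that $\rho(f_0\circ g,f_1\circ g)\leqslant\rho(f_0,f_1)$ and $\rho(h\circ f_0,h\circ f_1)\leqslant\rho(f_0,f_1)$ whenever the compositions make sense. A normed category is a pair $\langle\mathfrak K^{\heartsuit},\mathfrak K\rangle$ where $\mathfrak K$ is a metric-enriched category and $\mathfrak K^{\heartsuit}$ is a subcategory of $\mathfrak K$ with the same objects. For $f\in\mathfrak K$ put $\mu(f)=\inf\{\rho(j\circ f,i)\colon i,j\in\mathfrak K^{\heartsuit},\ \operatorname{dom}(j)=\operatorname{cod}(f),\ \operatorname{dom}(i)=\operatorname{dom}(f),\ \operatorname{cod}(i)=\operatorname{cod}(j)\}$, with $\inf\emptyset=+\infty$. The normed category has the almost amalgamation property if for all $\mathfrak K^{\heartsuit}$-arrows $f\colon c\to a$, $g\colon c\to b$ and every $\varepsilon>0$ there are $\mathfrak K^{\heartsuit}$-arrows $f'\colon a\to w$, $g'\colon b\to w$ with $\rho(f'\circ f,g'\circ g)<\varepsilon$. A sequence $\vec x$ in $\mathfrak K^{\heartsuit}$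 is a covariant functor from $\omega$ into $\mathfrak K^{\heartsuit}$, with objects $x_n$ and arrows $x_n^m\colon x_n\to x_m$ ($n\leqslant m$). An approximate arrow $\vec f\colon\vec x\to\vec y$ between sequences in $\mathfrak K^{\heartsuit}$ consists of an increasing map $\varphi\colon\omega\to\omega$ and $\mathfrak K$-arrows $f_n\colon x_n\to y_{\varphi(n)}$ such that for every $\varepsilon>0$ there is $n_0$ with $\rho(f_m\circ x_n^m,\ y_{\varphi(n)}^{\varphi(m)}\circ f_n)<\varepsilon$ whenever $n_0\leqslant n<m$. (Sequences are identified with their cofinal subsequences.) The distance of approximate arrows $\vec f=(f_n,\varphi)$, $\vec g=(g_n,\psi)$ from $\vec x$ to $\vec y$ is $\rho(\vec f,\vec g)=\lim_{n\to\infty}\lim_{m\to\infty}\rho(y_{\varphi(n)}^m\circ f_n,\ y_{\psi(n)}^m\circ g_n)$; approximate arrows at distance $0$ are identified. Sequences in $\mathfrak K^{\heartsuit}$ with approximate arrows form a category, and an approximate isomorphism is an isomorphism in it. For an approximate arrow, $\mu(\vec f)=\lim_{n\to\infty}\mu(f_n)$. A sequence $\vec u$ in $\mathfrak K^{\heartsuit}$ is Fraïssé in $\langle\mathfrak K^{\heartsuit},\mathfrak K\rangle$ if: (U) for every object $x$ and every $\varepsilon>0$ there are $n\in\omega$ and a $\mathfrak K$-arrow $f\colon x\to u_n$ with $\mu(f)<\varepsilon$; (A) given $\varepsilon>0$ and a $\mathfrak K^{\heartsuit}$-arrow $f\colon u_n\to y$, there are $m>n$ and a $\mathfrak K$-arrow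 $g\colon y\to u_m$ with $\mu(g)<\varepsilon$ and $\rho(u_n^m,g\circ f)<\varepsilon$. *)

(* Defs.v *)
From HB Require Import structures.
From mathcomp Require Import all_boot all_order all_algebra.
From mathcomp Require Import all_classical all_reals.
From mathcomp Require Import ereal topology normedtype sequences.

Set Implicit Arguments.
Unset Strict Implicit.
Unset Printing Implicit Defensive.

Import Order.TTheory GRing.Theory Num.Theory.
Import numFieldNormedType.Exports.

Local Open Scope classical_set_scope.
Local Open Scope ring_scope.
Local Open Scope ereal_scope.

Declare Scope mcat_scope.
Delimit Scope mcat_scope with mcat.

Record metric_category (R : realType) := MetricCategory {
  ob :> Type;
  hom : ob -> ob -> Type;
  idm : forall a, hom a a;
  comp : forall a b c, hom b c -> hom a b -> hom a c;
  compA : forall a b c d (h : hom c d) (g : hom b c) (f : hom a b),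
    comp h (comp g f) = comp (comp h g) f;
  comp1m : forall a b (f : hom a b), comp (idm b) f = f;
  compm1 : forall a b (f : hom a b), comp f (idm a) = f;
  rho : forall a b, hom a b -> hom a b -> \bar R;
  rho_ge0 : forall a b (f g : hom a b), 0 <= rho f g;
  rho_eq0 : forall a b (f g : hom a b), rho f g = 0 <-> f = g;
  rhoC : forall a b (f g : hom a b), rho f g = rho g f;
  rho_triangle : forall a b (f g h : hom a b),
    rho f h <= rho f g + rho g h;
  rho_compr : forall a b c (f0 f1 : hom b c) (g : hom a b),
    rho (comp f0 g) (comp f1 g) <= rho f0 f1;
  rho_compl : forall a b c (h : hom b c) (f0 f1 : hom a b),
    rho (comp h f0) (comp h f1) <= rho f0 f1 }.

Arguments idm {R} m a.

Notation "g \om f" := (comp g f) (at level 50, format "g  \om  f") : mcat_scope.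
Local Open Scope mcat_scope.

Record normed_category (R : realType) := NormedCategory {
  ncat :> metric_category R;
  heart : forall a b : ncat, set (hom a b);
  heart_id : forall a, heart (idm ncat a);
  heart_comp : forall a b c (g : hom b c) (f : hom a b),
    heart g -> heart f -> heart (g \om f) }.

Section NormedCategory.
Context {R : realType} (K : normed_category R).

Definition mu (a b : K) (f : hom a b) : \bar R :=
  ereal_inf [set d | exists (c : K) (j : hom b c) (i : hom a c),
                       [/\ heart j, heart i & d = rho (j \om f) i]].

Definition almost_amalgamation : Prop :=
  forall (c a b : K) (f : hom c a) (g : hom c b) (eps : R),
    heart f -> heart g -> (0 < eps)%R ->
    exists (w : K) (f' : hom a w) (g' : hom b w),
      [/\ heart f', heart g' & rho (f' \om f) (g' \om g) < eps%:E].

(* [sarr x nm] is the bonding map x_n^m; the proof [nm] is irrelevant since    *)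
(* [n <= m] is boolean                                                         *)
Record sequence := Sequence {
  sobj :> nat -> K;
  sarr : forall n m, (n <= m)%N -> hom (sobj n) (sobj m);
  sarr_heart : forall n m (nm : (n <= m)%N), heart (sarr nm);
  sarr_id : forall n, sarr (leqnn n) = idm K (sobj n);
  sarr_comp : forall n m k (nm : (n <= m)%N) (mk : (m <= k)%N),
    sarr mk \om sarr nm = sarr (leq_trans nm mk) }.

Arguments sarr s [n m] nm.

(* [aidx] is strictly increasing: for a bounded map composition would not be   *)
(* compatible with the identification of arrows at distance 0                  *)
Record approx_arrow (x y : sequence) := ApproxArrow {
  aidx : nat -> nat;
  aidx_incr : forall n m, (n < m)%N -> (aidx n < aidx m)%N;
  amap : forall n, hom (x n) (y (aidx n));
  amap_approx : forall eps : R, (0 < eps)%R ->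
    exists n0, forall n m (nm : (n < m)%N), (n0 <= n)%N ->
      rho (amap m \om sarr x (ltnW nm))
          (sarr y (ltnW (aidx_incr nm)) \om amap n) < eps%:E }.

Lemma le_aidx x y (f : approx_arrow x y) n : (n <= aidx f n)%N.
Proof.
by elim: n => // n IH; apply: leq_ltn_trans IH _; exact: aidx_incr.
Qed.

Lemma rhoxx (a b : K) (f : hom a b) : rho f f = 0.
Proof. exact/rho_eq0. Qed.

Program Definition aid (x : sequence) : approx_arrow x x :=
  @ApproxArrow x x id (fun _ _ => id) (fun n => idm K (x n)) _.
Next Obligation.
by exists 0%N => n m nm _; rewrite comp1m compm1 rhoxx lte_fin.
Qed.

Lemma acomp_approx x y z (g : approx_arrow y z) (f : approx_arrow x y)
    (eps : R) : (0 < eps)%R ->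
  exists n0, forall n m (nm : (n < m)%N), (n0 <= n)%N ->
    rho (amap g (aidx f m) \om amap f m \om sarr x (ltnW nm))
        (sarr z (ltnW (aidx_incr g (aidx_incr f nm))) \om
         (amap g (aidx f n) \om amap f n)) < eps%:E.
Proof.
move=> eps0; have e20 : (0 < eps / 2)%R by rewrite divr_gt0.
have [n1 H1] := amap_approx f e20; have [n2 H2] := amap_approx g e20.
exists (maxn n1 n2) => n m nm; rewrite geq_max => /andP[n1n n2n].
apply: le_lt_trans (rho_triangle _
  (amap g (aidx f m) \om sarr y (ltnW (aidx_incr f nm)) \om amap f n) _) _.
rewrite [eps]splitr EFinD; apply: lteD.
  rewrite -!compA; apply: le_lt_trans (rho_compl _ _ _) _; exact: H1.
rewrite compA; apply: le_lt_trans (rho_compr _ _ _) _.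
by apply: H2; exact: leq_trans n2n (le_aidx _ _).
Qed.

Definition acomp x y z (g : approx_arrow y z) (f : approx_arrow x y) :
    approx_arrow x z :=
  @ApproxArrow x z (aidx g \o aidx f)
    (fun n m nm => aidx_incr g (aidx_incr f nm))
    (fun n => amap g (aidx f n) \om amap f n)
    (@acomp_approx x y z g f).

Lemma leq_maxlD n m k : (n <= maxn n m + k)%N.
Proof. by rewrite (leq_trans (leq_maxl n m)) ?leq_addr. Qed.

Lemma leq_maxrD n m k : (m <= maxn n m + k)%N.
Proof. by rewrite (leq_trans (leq_maxr n m)) ?leq_addr. Qed.

(* rho (y_{phi n}^m \om f_n) (y_{psi n}^m \om g_n), which makes sense for      *)
(* m >= maxn (phi n) (psi n) only; hence the shift m = maxn _ _ + k            *)
Definition adist_at x y (f g : approx_arrow x y) (n k : nat) : \bar R :=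
  rho (sarr y (leq_maxlD (aidx f n) (aidx g n) k) \om amap f n)
      (sarr y (leq_maxrD (aidx f n) (aidx g n) k) \om amap g n).

Definition adist x y (f g : approx_arrow x y) : \bar R :=
  lim ((lim (adist_at f g n k @[k --> \oo])) @[n --> \oo]).

Definition amu x y (f : approx_arrow x y) : \bar R :=
  lim (mu (amap f n) @[n --> \oo]).

(* equality of arrows in the category of sequences and approximate arrows      *)
Definition aeq x y (f g : approx_arrow x y) : Prop := adist f g = 0.

Definition approx_iso x y (f : approx_arrow x y) : Prop :=
  exists g : approx_arrow y x,
    aeq (acomp g f) (aid x) /\ aeq (acomp f g) (aid y).

Definition Fraisse_sequence (u : sequence) : Prop :=
  (forall (x : K) (eps : R), (0 < eps)%R ->
     exists (n : nat) (f : hom x (u n)), mu f < eps%:E)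
  /\
  (forall (eps : R) (n : nat) (y : K) (f : hom (u n) y),
     (0 < eps)%R -> heart f ->
     exists (m : nat) (nm : (n < m)%N) (g : hom y (u m)),
       mu g < eps%:E /\ rho (sarr u (ltnW nm)) (g \om f) < eps%:E).

(* [lim] is a total function: the following lemmas show that the limits in     *)
(* [adist] and [amu] always exist                                              *)

Lemma almost_nondecreasing_is_cvg (d : (\bar R)^nat) :
  (forall eps : R, (0 < eps)%R -> exists n0, forall n m,
     (n0 <= n)%N -> (n < m)%N -> d n <= d m + eps%:E) ->
  cvgn d.
Proof.
move=> H.
have supinf : limn_esup d <= limn_einf d.
  apply/lee_addgt0Pr => e e0; have [n0 Hn0] := H e e0.
  rewrite limn_esup_lim; apply: lime_le; first exact: is_cvg_esups.
  exists n0 => // k /= n0k; apply: ge_ereal_sup => _ [n /= kn <-].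
  have n0n := leq_trans n0k kn.
  suff : d n <= einfs d n + e%:E.
    move/le_trans; apply; rewrite leeD2r// limn_einf_lim.
    apply: lime_ge; first exact: is_cvg_einfs.
    by exists n => // p /= np; exact: nondecreasing_einfs.
  rewrite -leeBlDr//; apply: le_ereal_inf_tmp => _ [m /= nm <-].
  change (d n - e%:E <= d m); rewrite leeBlDr//.
  move: nm; rewrite leq_eqVlt => /predU1P[<-|nm].
    by rewrite leeDl// lee_fin ltW.
  exact: Hn0.
apply: (@cvgP _ _ (limn_einf d)).
apply: (@squeeze_cvge _ _ _ _ (einfs d) _ (esups d)).
- apply: nearW => n; apply/andP; split.
    by apply: ereal_inf_lbound; exists n => /=.
  by apply: ereal_sup_ubound; exists n => /=.
- by rewrite limn_einf_lim; exact: is_cvg_einfs.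
- have -> : limn_einf d = limn_esup d.
    by apply/eqP; rewrite eq_le limn_einf_sup supinf.
  by rewrite limn_esup_lim; exact: is_cvg_esups.
Qed.

Lemma sarr_trans (x : sequence) n m k (nm : (n <= m)%N) (mk : (m <= k)%N)
    (nk : (n <= k)%N) : sarr x mk \om sarr x nm = sarr x nk.
Proof. by rewrite sarr_comp; congr sarr; exact: bool_irrelevance. Qed.

Lemma adist_at_nonincreasing x y (f g : approx_arrow x y) n :
  nonincreasing_seq (adist_at f g n).
Proof.
move=> k l kl; rewrite /adist_at.
have h : (maxn (aidx f n) (aidx g n) + k <=
          maxn (aidx f n) (aidx g n) + l)%N by rewrite leq_add2l.
rewrite -(sarr_trans y (leq_maxlD (aidx f n) (aidx g n) k) h).
rewrite -(sarr_trans y (leq_maxrD (aidx f n) (aidx g n) k) h).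
by rewrite -!compA; exact: rho_compl.
Qed.

Lemma is_cvg_adist_at x y (f g : approx_arrow x y) n :
  cvgn (adist_at f g n).
Proof.
exact: ereal_nonincreasing_is_cvgn (@adist_at_nonincreasing x y f g n).
Qed.

Lemma lim_adist_at_le x y (f g : approx_arrow x y) n N
    (fN : (aidx f n <= N)%N) (gN : (aidx g n <= N)%N) :
  limn (adist_at f g n) <= rho (sarr y fN \om amap f n) (sarr y gN \om amap g n).
Proof.
have hN : N = (maxn (aidx f n) (aidx g n) +
               (N - maxn (aidx f n) (aidx g n)))%N.
  by rewrite subnKC// geq_max fN gN.
move: (N - _)%N hN => k hN; move: fN gN; rewrite hN => fN gN.
rewrite (cvg_lim _ (ereal_nonincreasing_cvgn
  (@adist_at_nonincreasing x y f g n)))//.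
apply: ereal_inf_lbound; exists k => //; rewrite /adist_at.
rewrite (bool_irrelevance fN (leq_maxlD (aidx f n) (aidx g n) k)).
by rewrite (bool_irrelevance gN (leq_maxrD (aidx f n) (aidx g n) k)).
Qed.

Lemma is_cvg_adist x y (f g : approx_arrow x y) :
  cvgn (fun n => limn (adist_at f g n)).
Proof.
apply: almost_nondecreasing_is_cvg => e e0.
have e20 : (0 < e / 2)%R by rewrite divr_gt0.
have [n1 H1] := amap_approx f e20; have [n2 H2] := amap_approx g e20.
exists (maxn n1 n2) => n m; rewrite geq_max => /andP[n1n n2n] nm.
rewrite -leeBlDr//; apply: lime_ge; first exact: is_cvg_adist_at.
apply: nearW => k; change (limn (adist_at f g n) - e%:E <= adist_at f g m k); rewrite leeBlDr//.
have fN := leq_maxlD (aidx f m) (aidx g m) k.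
have gN := leq_maxrD (aidx f m) (aidx g m) k.
pose fnm := ltnW (aidx_incr f nm); pose gnm := ltnW (aidx_incr g nm).
apply: le_trans (lim_adist_at_le (leq_trans fnm fN) (leq_trans gnm gN)) _.
rewrite -!sarr_comp -!compA.
apply: le_trans (rho_triangle _
  (sarr y fN \om (amap f m \om sarr x (ltnW nm))) _) _.
rewrite [e]splitr EFinD [leRHS]addeA [leRHS]addeAC; rewrite [leRHS]addeC.
apply: leeD.
  by rewrite rhoC; apply: le_trans (rho_compl _ _ _) _; exact/ltW/H1.
apply: le_trans (rho_triangle _
  (sarr y gN \om (amap g m \om sarr x (ltnW nm))) _) _.
apply: leeD; last by apply: le_trans (rho_compl _ _ _) _; exact/ltW/H2.
rewrite !compA; apply: le_trans (rho_compr _ _ _) _; rewrite /adist_at.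
rewrite (bool_irrelevance fN (leq_maxlD (aidx f m) (aidx g m) k)).
by rewrite (bool_irrelevance gN (leq_maxrD (aidx f m) (aidx g m) k)).
Qed.

Lemma is_cvg_amu x y (f : approx_arrow x y) :
  cvgn (fun n => mu (amap f n)).
Proof.
apply: almost_nondecreasing_is_cvg => e e0.
have [n1 H1] := amap_approx f e0.
exists n1 => n m n1n nm; rewrite -leeBlDr//.
apply: le_ereal_inf_tmp => _ [c [j [i [hj hi ->]]]]; rewrite leeBlDr//.
apply: (@le_trans _ _ (rho
  (j \om sarr y (ltnW (aidx_incr f nm)) \om amap f n)
  (i \om sarr x (ltnW nm)))).
  apply: ereal_inf_lbound; exists c, (j \om sarr y (ltnW (aidx_incr f nm))),
    (i \om sarr x (ltnW nm)).
  by split=> //; apply: heart_comp => //; exact: sarr_heart.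
apply: le_trans (rho_triangle _ (j \om (amap f m \om sarr x (ltnW nm))) _) _.
rewrite addeC; apply: leeD.
  by rewrite compA; exact: rho_compr.
rewrite rhoC -compA; apply: le_trans (rho_compl _ _ _) _; exact/ltW/H1.
Qed.

End NormedCategory.

(* Main.v *)
From mathcomp Require Import all_boot all_order all_algebra.
From mathcomp Require Import all_classical all_reals.
From mathcomp Require Import ereal topology normedtype sequences.
From mathcomp Require Import lra.
Require Import Defs.

(** Two Fraisse sequences are matched by an approximate back-and-forth.

    The engine is [exists_approx_retraction]: an arrow f : u_n -> y of small
    norm has an approximate left inverse of small norm into the sequence u.
    Indeed mu f < d provides heart arrows j, i with j f within d of i; both i
    and j end in the same object, property (A) for i gives g with g i close to
    a bonding map of u, and g j is the required left inverse. Its norm is at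
    most that of g since j is a heart arrow ([mu_comp_heart]).

    By property (U) for v there is a first arrow u_0 -> v_b of small norm.
    Applying the engine alternately to u and to v, with tolerances halved at
    each turn, gives a zigzag u_{a 0} -> v_{b 0} -> u_{a 1} -> v_{b 1} -> ...
    in which two consecutive arrows compose to a bonding map up to 2^-n
    ([back_and_forth]). As these errors are summable, squares of any length
    commute up to 4 * 2^-n ([zig_natural]); hence the arrows u_{a n} -> v_{b n},
    precomposed with the bonding maps u_n -> u_{a n}, form an approximate arrow
    ([zarrow]), whose norm is 0 since the norms of its components tend to 0.

    The arrows v_{b n} -> u_{a n.+1} form a zigzag from v to u ([zflip]), which
    gives an approximate arrow in the other direction. Going forth and back
    differs from a bonding map by 5 * 2^-n at most ([zag_retracts],
    [zig_retracts]), so both composites are at distance 0 from identities. *)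

Set Implicit Arguments.
Unset Strict Implicit.
Unset Printing Implicit Defensive.

Import Order.TTheory GRing.Theory Num.Theory.
Import numFieldNormedType.Exports.

Local Open Scope classical_set_scope.
Local Open Scope ring_scope.
Local Open Scope ereal_scope.
Local Open Scope mcat_scope.

(** * Norms and approximate left inverses *)

Section BackAndForth.
Context {R : realType} {K : normed_category R}.
Implicit Types u v : sequence K.

Lemma rho_le_trans (a b : K) (f g h : hom a b) (d e : R) :
  rho f g <= d%:E -> rho g h <= e%:E -> rho f h <= (d + e)%:E.
Proof.
by move=> fg gh; apply: le_trans (rho_triangle f g h) _; rewrite EFinD leeD.
Qed.

Lemma mu_ge0 (a b : K) (f : hom a b) : 0 <= mu f.
Proof.
by apply: le_ereal_inf_tmp => _ [c [j [i [_ _ ->]]]]; exact: rho_ge0.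
Qed.

(** A heart arrow j may be absorbed in the second witness: if (k, i) witnesses
    the norm of g, then (k, i j) witnesses that of g j. *)
Lemma mu_comp_heart (a b c : K) (g : hom b c) (j : hom a b) :
  heart j -> mu (g \om j) <= mu g.
Proof.
move=> hj; apply: le_ereal_inf_tmp => _ [d [k [i [hk hi ->]]]].
apply: (@le_trans _ _ (rho (k \om (g \om j)) (i \om j))).
  apply: ereal_inf_lbound; exists d, k, (i \om j).
  by split=> //; exact: heart_comp.
by rewrite compA; exact: rho_compr.
Qed.

(** The arrow [f] need not lie in the heart, so (A) does not apply to it; it
    applies to the heart arrow [i] that [j \om f] approximates, and the answer
    is transported back along [j]. *)
Lemma exists_approx_retraction u (uF : Fraisse_sequence u) n (y : K)
    (f : hom (u n) y) (d e : R) : (0 < e)%R -> mu f < d%:E ->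
  exists m (nm : (n < m)%N) (g : hom y (u m)),
    mu g < e%:E /\ rho (sarr u (ltnW nm)) (g \om f) <= (d + e)%:E.
Proof.
move=> e0 /ereal_inf_lt[_ [w [j [i [hj hi ->]]]] jfi].
have [m [nm [g [mug gi]]]] := uF.2 _ _ _ i e0 hi.
exists m, nm, (g \om j); split.
  exact: le_lt_trans (mu_comp_heart g hj) mug.
rewrite addrC; apply: (rho_le_trans (ltW gi)).
rewrite -compA rhoC; apply: le_trans (rho_compl _ _ _) _; exact: ltW.
Qed.

(** * Geometric tolerances *)

Definition tol (n : nat) : R := (2^-1 ^+ n)%R.

Lemma tol_gt0 n : (0 < tol n)%R.
Proof. by rewrite exprn_gt0// invr_gt0. Qed.

Lemma tolS n : (tol n = tol n.+1 + tol n.+1)%R.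
Proof. by rewrite /tol exprS; lra. Qed.

Lemma tol_anti m n : (m <= n)%N -> (tol n <= tol m)%R.
Proof.
elim: n => [|n IH]; first by rewrite leqn0 => /eqP->.
rewrite leq_eqVlt => /predU1P[->//|/IH].
by have := tolS n; have := tol_gt0 n.+1; lra.
Qed.

Lemma cvg_tol : (tol n @[n --> \oo] --> 0)%R.
Proof. by apply: cvg_expr; rewrite ger0_norm; lra. Qed.

Lemma limn_eq0_tol (d : (\bar R)^nat) (c : R) : (forall n, 0 <= d n) ->
  (forall n, d n <= (c * tol n)%:E) -> limn d = 0.
Proof.
move=> d0 dc; apply/cvg_lim => //.
apply: (@squeeze_cvge _ _ _ _ (cst 0) _ (fun n => (c * tol n)%:E)).
- by apply: nearW => n; rewrite d0 dc.
- exact: cvg_cst.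
- apply/fine_cvgP; split; first exact: nearW.
  rewrite -[X in _ --> X](mulr0 c); exact: cvgMr cvg_tol.
Qed.

(** * Zigzags *)

(** The two error bounds hold for every proof [h] of the index inequality, so
    that no particular proof has to be carried around. Both bounds at [n] are
    [tol n], which is what makes the notion stable under [zflip]. *)
Record zigzag u v := Zigzag {
  zl : nat -> nat;
  zr : nat -> nat;
  zl_lt : forall n, (zl n < zl n.+1)%N;
  zr_lt : forall n, (zr n < zr n.+1)%N;
  zig : forall n, hom (u (zl n)) (v (zr n));
  zag : forall n, hom (v (zr n)) (u (zl n.+1));
  mu_zig : forall n, mu (zig n) <= (tol n)%:E;
  mu_zag : forall n, mu (zag n) <= (tol n)%:E;
  zag_zig : forall n (h : (zl n <= zl n.+1)%N),
    rho (sarr u h) (zag n \om zig n) <= (tol n)%:E;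
  zig_zag : forall n (h : (zr n <= zr n.+1)%N),
    rho (sarr v h) (zig n.+1 \om zag n) <= (tol n)%:E }.

Section Existence.
Variables (u v : sequence K).
Hypotheses (uF : Fraisse_sequence u) (vF : Fraisse_sequence v).

(** The tolerance depends on the turn [k], hence so does the type: each turn
    needs the norm bound left by the preceding one. *)
Record stage (k : nat) := Stage {
  sl : nat;
  sr : nat;
  szig : hom (u sl) (v sr);
  mu_szig : mu szig < (tol k.+1)%:E }.

Lemma stage0 : stage 0.
Proof.
have /cid[m /cid[f muf]] := vF.1 (u 0%N) _ (tol_gt0 1).
exact: Stage muf.
Qed.

(** One turn back and one turn forth. The stated errors come from
    tol k.+1 + tol k.+1 = tol k and tol k.+1 + tol k.+2 <= tol k. *)
Lemma next_stage k (s : stage k) :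
  {t : stage k.+1 & {g : hom (v (sr s)) (u (sl t)) |
    [/\ (sl s < sl t)%N, (sr s < sr t)%N, mu g <= (tol k)%:E,
        forall h : (sl s <= sl t)%N,
          rho (sarr u h) (g \om szig s) <= (tol k)%:E &
        forall h : (sr s <= sr t)%N,
          rho (sarr v h) (szig t \om g) <= (tol k)%:E]}}.
Proof.
have /cid[a /cid[sa /cid[g [mug gf]]]] :=
  exists_approx_retraction uF (tol_gt0 k.+1) (mu_szig s).
have /cid[b /cid[sb /cid[f [muf fg]]]] :=
  exists_approx_retraction vF (tol_gt0 k.+2) mug.
exists (Stage muf), g; split => //= [|h|h].
- by apply/ltW/(lt_le_trans mug); rewrite lee_fin tol_anti.
- by rewrite (bool_irrelevance h (ltnW sa)) tolS.
- rewrite (bool_irrelevance h (ltnW sb)); apply: le_trans fg _.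
  by rewrite lee_fin (tolS k) lerD2l tol_anti.
Qed.

Fixpoint stages k : stage k :=
  if k is k'.+1 then projT1 (next_stage (stages k')) else stage0.

Lemma back_and_forth : zigzag u v.
Proof.
pose g k := projT2 (next_stage (stages k)).
apply: (@Zigzag u v (fun k => sl (stages k)) (fun k => sr (stages k)) _ _
  (fun k => szig (stages k)) (fun k => sval (g k))) => n.
- by case: (svalP (g n)).
- by case: (svalP (g n)).
- by apply/ltW/(lt_le_trans (mu_szig _)); rewrite lee_fin tol_anti.
- by case: (svalP (g n)).
- by case: (svalP (g n)).
- by case: (svalP (g n)).
Qed.

End Existence.

Lemma tolS_le (x : \bar R) n : x <= (tol n.+1)%:E -> x <= (tol n)%:E.
Proof. by move/le_trans; apply; rewrite lee_fin tol_anti. Qed.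

(** Reading a zigzag from its second arrow on exchanges the two sequences, so
    that each statement on zigzags has a mirror image. *)
Definition zflip u v (z : zigzag u v) : zigzag v u :=
  @Zigzag v u (zr z) (fun n => zl z n.+1) (zr_lt z) (fun n => zl_lt z n.+1)
    (zag z) (fun n => zig z n.+1) (mu_zag z)
    (fun n => tolS_le (mu_zig z n.+1)) (fun n h => zig_zag h)
    (fun n h => tolS_le (zag_zig h)).

(** * The approximate arrow of a zigzag *)

Section Arrow.
Variables (u v : sequence K) (z : zigzag u v).

Lemma zl_mono : {homo zl z : m n / (m <= n)%N}.
Proof. by apply: homo_leq leq_trans _ => // n; exact/ltnW/zl_lt. Qed.

Lemma zr_incr : {homo zr z : m n / (m < n)%N}.
Proof. exact: (homo_ltn ltn_trans (zr_lt z)). Qed.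

Lemma leq_zl n : (n <= zl z n)%N.
Proof. by elim: n => // n IH; exact: leq_ltn_trans IH (zl_lt z n). Qed.

(** The square over n <= n.+1 is filled by the zag in between, each of its two
    triangles costing at most [tol n]; longer squares are pasted from these, at
    a cost of 2 * (tol n + tol n.+1 + ...) <= 4 * tol n. *)
Lemma zig_natural n k (nk : (n <= k)%N) (hl : (zl z n <= zl z k)%N)
    (hr : (zr z n <= zr z k)%N) :
  rho (zig z k \om sarr u hl) (sarr v hr \om zig z n) <= (4 * tol n)%:E.
Proof.
move: hl hr; rewrite -(subnK nk); move: (k - n)%N => {nk k} d.
elim: d n => [|d IH] n.
  rewrite add0n => hl hr.
  rewrite (bool_irrelevance hl (leqnn _)) (bool_irrelevance hr (leqnn _)).
  rewrite !sarr_id compm1 comp1m rhoxx lee_fin mulr_ge0// ltW// tol_gt0//.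
rewrite addSnnS => hl hr.
have n1 : (n.+1 <= d + n.+1)%N by rewrite leq_addl.
have hl1 := ltnW (zl_lt z n); have hr1 := ltnW (zr_lt z n).
have hl2 := zl_mono n1; have hr2 := ltnW_homo zr_incr n1.
rewrite -(sarr_trans u hl1 hl2) -(sarr_trans v hr1 hr2) -compA.
(* the sum of the geometric series, as the invariant of the induction *)
have -> : (4 * tol n = 4 * tol n.+1 + (tol n + tol n))%R.
  by rewrite (tolS n); lra.
apply: (rho_le_trans (g := (sarr v hr2 \om zig z n.+1) \om sarr u hl1)).
  by rewrite compA; apply: le_trans (rho_compr _ _ _) (IH _ _ _).
rewrite -!compA; apply: le_trans (rho_compl _ _ _) _.
apply: (rho_le_trans (g := zig z n.+1 \om (zag z n \om zig z n))).
  by apply: le_trans (rho_compl _ _ _) (zag_zig _).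
rewrite compA rhoC; exact: le_trans (rho_compr _ _ _) (zig_zag _).
Qed.

(** Naturality replaces the detour through v by [zig z k], which [zag z k]
    nearly inverts. *)
Lemma zag_retracts n k (nk : (n <= k)%N) (hl : (zl z n <= zl z k.+1)%N)
    (hr : (zr z n <= zr z k)%N) :
  rho (zag z k \om (sarr v hr \om zig z n)) (sarr u hl) <= (5 * tol n)%:E.
Proof.
have -> : (5 * tol n = 4 * tol n + tol n)%R by lra.
have hl1 := zl_mono nk; have hl2 := ltnW (zl_lt z k).
apply: (rho_le_trans (g := zag z k \om (zig z k \om sarr u hl1))).
  rewrite rhoC; exact: le_trans (rho_compl _ _ _) (zig_natural nk _ _).
rewrite -(sarr_trans u hl1 hl2) compA rhoC.
apply: le_trans (rho_compr _ _ _) _.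
by apply: le_trans (zag_zig _) _; rewrite lee_fin tol_anti.
Qed.

(** An approximate arrow has a component at every index, while the zigzag lives
    on the subsequence [zl z]; the missing components start with a bonding map. *)
Definition zmap n : hom (u n) (v (zr z n)) := zig z n \om sarr u (leq_zl n).

Lemma zmap_natural n m (nm : (n < m)%N) (h : (zr z n <= zr z m)%N) :
  rho (zmap m \om sarr u (ltnW nm)) (sarr v h \om zmap n) <= (4 * tol n)%:E.
Proof.
have hl := zl_mono (ltnW nm).
rewrite /zmap -compA (sarr_trans u _ _ (leq_trans (ltnW nm) (leq_zl m))).
rewrite -(sarr_trans u (leq_zl n) hl) !compA.
exact: le_trans (rho_compr _ _ _) (zig_natural (ltnW nm) _ _).
Qed.

Lemma zmap_approx (eps : R) : (0 < eps)%R ->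
  exists n0, forall n m (nm : (n < m)%N), (n0 <= n)%N ->
    rho (zmap m \om sarr u (ltnW nm))
        (sarr v (ltnW (zr_incr nm)) \om zmap n) < eps%:E.
Proof.
move=> eps0; have e0 : (0 < eps / 4)%R by lra.
have [n0 _ Hn0] := cvgr0_norm_lt _ cvg_tol _ e0.
exists n0 => n m nm n0n; apply: le_lt_trans (zmap_natural _ _) _.
have := Hn0 n n0n; rewrite /= ger0_norm ?ltW ?tol_gt0// lte_fin; lra.
Qed.

Definition zarrow : approx_arrow u v :=
  @ApproxArrow R K u v (zr z) zr_incr zmap zmap_approx.

Lemma amu_zarrow : amu zarrow = 0.
Proof.
apply: (limn_eq0_tol (c := 1)) => n; first exact: mu_ge0.
rewrite mul1r; apply: le_trans (mu_zig z n).
exact/mu_comp_heart/sarr_heart.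
Qed.

End Arrow.

(** * The two composites *)

(** The mirror image of [zag_retracts]: the zags of [zflip z] are the zigs of
    [z] with index shifted by one, whence the strict bound n < l. *)
Lemma zig_retracts u v (z : zigzag u v) n l (nl : (n < l)%N)
    (hl : (zl z n.+1 <= zl z l)%N) (hr : (zr z n <= zr z l)%N) :
  rho (zig z l \om (sarr u hl \om zag z n)) (sarr v hr) <= (5 * tol n)%:E.
Proof.
by case: l nl hl hr => // l nl hl hr; exact: (@zag_retracts _ _ (zflip z)).
Qed.

(** Comparing with the identity takes place in u_{aidx f n}, the first object
    where both arrows can be compared; the limit over later objects can only
    be smaller. *)
Lemma aeq_aid u (f : approx_arrow u u) (c : R) :
  (forall n, rho (amap f n) (sarr u (le_aidx f n)) <= (c * tol n)%:E) ->
  aeq f (aid u).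
Proof.
move=> fc; apply: (limn_eq0_tol (c := c)) => n.
  apply: lime_ge; first exact: is_cvg_adist_at.
  by apply: nearW => k; exact: rho_ge0.
apply: le_trans (lim_adist_at_le (f := f) (g := aid u) (leqnn _) (le_aidx f n)) _.
by rewrite sarr_id comp1m compm1.
Qed.

Lemma zflip_left_inverse u v (z : zigzag u v) :
  aeq (acomp (zarrow (zflip z)) (zarrow z)) (aid u).
Proof.
apply: (aeq_aid (c := 5)) => n /=.
set k := zr z n.
have nk : (n <= k)%N by exact: le_aidx (zarrow z) n.
have hl : (zl z n <= zl z k.+1)%N by apply: zl_mono; exact: leqW.
rewrite -(sarr_trans u (leq_zl z n) hl) /zmap -!compA.
rewrite [X in zag z k \om X]compA compA.
apply: le_trans (rho_compr _ _ _) _; exact: zag_retracts.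
Qed.

Lemma zflip_right_inverse u v (z : zigzag u v) :
  aeq (acomp (zarrow z) (zarrow (zflip z))) (aid v).
Proof.
apply: (aeq_aid (c := 5)) => n /=.
set l := zl z n.+1.
have nl : (n < l)%N by exact: leq_zl.
have hr : (zr z n <= zr z l)%N by exact: ltnW (zr_incr z nl).
rewrite -(sarr_trans v (leq_zl (zflip z) n) hr) /zmap -!compA.
rewrite [X in zig z l \om X]compA compA.
by apply: le_trans (rho_compr _ _ _) _; exact: zig_retracts.
Qed.

End BackAndForth.

Theorem theorem3p5 (R : realType) (K : normed_category R)
    (amalg : almost_amalgamation K) (u v : sequence K)
    (uF : Fraisse_sequence u) (vF : Fraisse_sequence v) :
  exists H : approx_arrow u v, approx_iso H /\ amu H = 0.
Proof.
have z := back_and_forth uF vF.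
exists (zarrow z); split; last exact: amu_zarrow.
exists (zarrow (zflip z)); split; first exact: zflip_left_inverse.
exact: zflip_right_inverse.
Qed.
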